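(* Let $n\ge 1$ and let $\nabla_{2n+1}(z)$ be the symmetric Laurent representative of the Alexander polynomial of $Th(4,2n+1)$, i.e. $$\nabla_{2n+1}(z)=z^{-3n}A_{2n+1}(z),\qquad A_{2n+1}(z)=-z^{2n+1}\,\frac{\det\big(I-M(-z)^{2n+1}\big)}{1-z+z^2-z^3}.$$ With $u=z+z^{-1}$, $\nabla_{2n+1}(z)$ is a polynomial in $u$ with integer coefficients: writing $B_{2n+1}(u)=\nabla_{2n+1}(z)$, one has in $\mathbb{Z}[u]$ $$B_{2n+1}(u)=F_n(u)\,F_n(u+2)^2,$$ where $F_n(u)=U_n(u/2)+U_{n-1}(u/2)$.
   Context: $U_k$ denotes the Chebyshev polynomial of the second kind, $U_k(\cos\theta)=\sin((k+1)\theta)/\sin\theta$. The matrix $$M(t)=\begin{pmatrix}1-t&1-t^{-1}&-1\\1&1-t^{-1}&-1\\0&t&-t\end{pmatrix}$$ is the image of $\sigma_1\sigma_2^{-1}\sigma_3\in B_4$ under the reduced Burau representation over $\mathbb{Z}[t,t^{-1}]$, and $M(-z)$ is its evaluation at $t=-z$. $Th(4,q)$ is the closure of $(\sigma_1\sigma_2^{-1}\sigma_3)^q$. *)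

(* Defs.v *)
From HB Require Import structures.
From mathcomp Require Import all_boot all_order all_algebra.
From mathcomp Require Import ring.
From mathcomp Require Import reals trigo.

Set Implicit Arguments.
Unset Strict Implicit.
Unset Printing Implicit Defensive.

Import Order.TTheory GRing.Theory Num.Theory.
Local Open Scope ring_scope.

Definition mx3 (K : nzRingType) (a b c d e f g h k : K) : 'M[K]_3 :=
  \matrix_(i, j) nth 0 (nth [::] [:: [:: a; b; c]; [:: d; e; f]; [:: g; h; k]] i) j.

Definition burauM (K : unitRingType) (t : K) : 'M[K]_3 :=
  mx3 (1 - t) (1 - t^-1) (- 1)
      1       (1 - t^-1) (- 1)
      0       t          (- t).

(* Reduced Burau images of the generators of the braid group B_4; by
   [burauM_braid], [burauM] is the image of s_1 s_2^-1 s_3, whose q-th power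
   closes up to Th(4, q). *)
Definition burau1 (K : unitRingType) (t : K) : 'M[K]_3 :=
  mx3 (- t) 1 0  0 1 0  0 0 1.
Definition burau2 (K : unitRingType) (t : K) : 'M[K]_3 :=
  mx3 1 0 0  t (- t) 1  0 0 1.
Definition burau3 (K : unitRingType) (t : K) : 'M[K]_3 :=
  mx3 1 0 0  0 1 0  0 t (- t).

Lemma burauM_braid (K : fieldType) (t : K) : t != 0 ->
  burauM t = burau1 t *m invmx (burau2 t) *m burau3 t.
Proof.
move=> t0.
pose V : 'M[K]_3 := mx3 1 0 0  1 (- t^-1) t^-1  0 0 1.
have VE : burau2 t *m V = 1%:M.
  apply/matrixP=> -[[|[|[|//]]] Hi] -[[|[|[|//]]] Hj];
  rewrite !mxE !big_ord_recl big_ord0 !mxE /=; by field.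
have U2 := proj1 (mulmx1_unit VE).
have -> : invmx (burau2 t) = V by rewrite -[LHS]mulmx1 -VE mulKmx.
apply/matrixP=> -[[|[|[|//]]] Hi] -[[|[|[|//]]] Hj];
rewrite !mxE ?big_ord_recl ?big_ord0 !mxE ?big_ord_recl ?big_ord0 !mxE /=;
by field.
Qed.

(* [Z[z, 1/z]] is seen inside its field of fractions [Z(z)]. *)
Definition ratz : fieldType := {fraction {poly int}}.

Definition zvar : ratz := FracField.tofrac ('X : {poly int}).

(* [alexA n] is $A_{2n+1}$ and [nabla n] is $\nabla_{2n+1}$. *)
Definition alexA (n : nat) : ratz :=
  - zvar ^+ (2 * n + 1) * \det (1%:M - burauM (- zvar) ^+ (2 * n + 1))
    / (1 - zvar + zvar ^+ 2 - zvar ^+ 3).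

Definition nabla (n : nat) : ratz := zvar ^- (3 * n) * alexA n.

Definition at_u (P : {poly int}) : ratz := (map_poly intr P).[zvar + zvar^-1].

Definition is_chebyshevU (R : realType) (k : nat) (P : {poly R}) : Prop :=
  forall theta : R, sin theta != 0 ->
    P.[cos theta] = sin (k.+1%:R * theta) / sin theta.

Lemma chebyshevU_exists (R : realType) :
  exists U : nat -> {poly R}, forall k, is_chebyshevU k (U k).
Proof.
pose step (p : {poly R} * {poly R}) := (p.2, 2%:R *: 'X * p.2 - p.1).
exists (fun k => (iter k step (0, 1)).2) => k t st.
suff [] : (iter k step (0, 1)).1.[cos t] = sin (k%:R * t) / sin t /\
  (iter k step (0, 1)).2.[cos t] = sin (k.+1%:R * t) / sin t by [].
elim: k => [|k [IH1 IH2]].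
  by rewrite /= mul0r sin0 mul0r mul1r divff // !hornerE.
split; first by rewrite iterS.
rewrite iterS /= !hornerE IH1 IH2.
have -> : k.+2%:R * t = k.+1%:R * t + t by rewrite -natr1; ring.
have -> : k%:R * t = k.+1%:R * t + - t by rewrite -[k.+1%:R]natr1; ring.
by rewrite !sinD sinN cosN; field.
Qed.

(* $F_n(u) = U_n(u/2) + U_{n-1}(u/2)$; used only for [0 < n]. *)
Definition chebF (R : realType) (U : nat -> {poly R}) (n : nat) : {poly R} :=
  (U n + U n.-1) \Po (2%:R^-1 *: 'X).

(* Main.v *)
Require Import Defs.
From mathcomp Require Import all_boot all_order all_algebra.
From mathcomp Require Import ring.
From mathcomp Require Import reals trigo.

(** The row [(1, -1, 1)] is a left eigenvector of [M(-z)], with eigenvalue [z],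
    and the matrix [N] induced on the quotient of the row space by that line has
    determinant 1 and trace [z + 1/z + 2].  Hence, with [q = 2n+1],
      [det (1 - M(-z)^q) = (1 - z^q) * det (1 - N^q)]
    ([burauM_block], [det_sub1_lblock]).

    Both factors are computed by one identity ([expr_odd_sub1]): if an element
    [x] of an algebra satisfies [x^2 + 1 = v x], which reads [v = x + 1/x] when
    [x] is invertible, then
      [x^q - 1 = F_n(v) (x - 1) x^n],
    because [x^-n + ... + x^n] is a polynomial in [x + 1/x] which obeys the
    Chebyshev recursion, namely [F_n].  With [x = z] it gives the factor
    [F_n(u)], and with [x = N], where [x^2 + 1 = v x] is Cayley-Hamilton, it
    gives, since the determinant of a 2x2 matrix is quadratic, the factor
    [F_n(u + 2)^2].  What remains, [(z - 1) z^n det (N - 1)] where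
    [det (N - 1) = -u], is what the normalization of the Alexander polynomial
    cancels ([nabla_normalization]).

    Two facts connect this with the statement.  A polynomial in [u] is determined
    by its value at [z + 1/z], as [z + 1/z] is transcendental over the integers
    ([at_u_inj]); and the integral polynomial [F_n] given by the recursion is
    [U_n(u/2) + U_(n-1)(u/2)], as both agree at [u = 2 cos t] ([chebW_chebF]). *)

Set Implicit Arguments.
Unset Strict Implicit.
Unset Printing Implicit Defensive.

Import Order.TTheory GRing.Theory Num.Theory.

Local Open Scope ring_scope.

(** * The Chebyshev-type polynomials F_n *)

(** The rescaled Chebyshev polynomials of the fourth kind,
    [F_n(2 cos t) = sin ((n + 1/2) t) / sin (t/2)].  The recursion keeps the
    coefficients integral, which the definition through [u/2] hides. *)
Fixpoint chebW (n : nat) : {poly int} :=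
  if n is m.+1 then
    if m is k.+1 then 'X * chebW m - chebW k else 'X + 1
  else 1.

Definition chebW_at (K : comNzRingType) (n : nat) (v : K) : K :=
  (map_poly intr (chebW n)).[v].

Lemma chebW_at0 (K : comNzRingType) (v : K) : chebW_at 0 v = 1.
Proof. by rewrite /chebW_at /= rmorph1 hornerC. Qed.

Lemma chebW_at1 (K : comNzRingType) (v : K) : chebW_at 1 v = v + 1.
Proof. by rewrite /chebW_at /= rmorphD rmorph1 /= map_polyX hornerD hornerX hornerC. Qed.

Lemma chebW_atSS (K : comNzRingType) (n : nat) (v : K) :
  chebW_at n.+2 v = v * chebW_at n.+1 v - chebW_at n v.
Proof.
rewrite /chebW_at -[chebW n.+2]/('X * chebW n.+1 - chebW n).
by rewrite rmorphB rmorphM /= map_polyX hornerD hornerN hornerM hornerX.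
Qed.

(** With [a_n = x^(2n+1) - 1] and [b_n = (x - 1) x^n F_n(v)], both sequences
    satisfy [s_(n+2) = (x^2 + 1) s_(n+1) - x^2 s_n]; for [b] this is the
    recursion of [F] multiplied by [(x - 1) x^(n+2)], with [v x] replaced by
    [x^2 + 1].  In an algebra, [x] can be a matrix as well as a scalar. *)
Lemma expr_odd_sub1 (K : comNzRingType) (A : algType K) (x : A) (v : K) (n : nat) :
  x ^+ 2 + 1 = v *: x -> x ^+ (2 * n + 1) - 1 = chebW_at n v *: ((x - 1) * x ^+ n).
Proof.
move=> hx.
have [] // : x ^+ (2 * n + 1) - 1 = chebW_at n v *: ((x - 1) * x ^+ n) /\
  x ^+ (2 * n.+1 + 1) - 1 = chebW_at n.+1 v *: ((x - 1) * x ^+ n.+1).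
elim: n => [|n [IH0 IH1]].
  rewrite chebW_at0 chebW_at1 scale1r mulr1 expr1; split=> //.
  rewrite scalerDl scale1r scalerAr -hx mulrDr mulr1 !mulrBl !mul1r -expr2 -exprS.
  by rewrite addrACA subrK addrAC subrr add0r.
split=> //.
have -> : x ^+ (2 * n.+2 + 1) - 1 =
    (x ^+ (2 * n.+1 + 1) - 1) * (x ^+ 2 + 1) - (x ^+ (2 * n + 1) - 1) * x ^+ 2.
  rewrite mulrDr mulr1 !mulrBl !mul1r -!exprD.
  have -> : (2 * n + 1 + 2 = 2 * n.+1 + 1)%N by rewrite mulnS addnC addnA.
  have -> : (2 * n.+1 + 1 + 2 = 2 * n.+2 + 1)%N by rewrite (mulnS 2 n.+1) addnC addnA.
  by rewrite opprB [RHS]addrAC !addrA !subrK.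
rewrite IH1 IH0 chebW_atSS scalerBl -!scalerAl -!mulrA -exprD addn2; congr (_ - _).
by rewrite hx -scalerAr -exprSr -scalerAr scalerA mulrC.
Qed.

(** * The determinant of 1 - M(-z)^(2n+1) *)

Lemma det_sub1_lblock (K : comNzRingType) (m n : nat) (A : 'M[K]_m.+1)
    (C : 'M[K]_(n.+1, m.+1)) (D : 'M[K]_n.+1) (k : nat) :
  \det (1%:M - (block_mx A 0 C D : 'M_(m.+1 + n.+1)) ^+ k) =
  \det (1%:M - A ^+ k) * \det (1%:M - D ^+ k).
Proof.
have [C' ->] : exists C', (block_mx A 0 C D : 'M_(m.+1 + n.+1)) ^+ k =
    block_mx (A ^+ k) 0 C' (D ^+ k).
  elim: k => [|k [C' IH]].
    by exists 0; rewrite !expr0; exact: scalar_mx_block.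
  exists (C *m A ^+ k + D *m C').
  by rewrite exprS IH -[LHS]/(_ *m _) mulmx_block !mul0mx !mulmx0 !addr0 !add0r !exprS.
by rewrite scalar_mx_block opp_block_mx add_block_mx subr0 det_lblock.
Qed.

(** The matrix that [burauM t] induces on the quotient of the row space by its
    eigenline spanned by [(1, -1, 1)]. *)
Definition burau_quot (K : fieldType) (t : K) : 'M[K]_2 :=
  \matrix_(i, j) nth 0 (nth [::] [:: [:: 2%:R - t^-1; - 2%:R]; [:: t; - t]] i) j.

(** [S] is the change of basis that puts the eigenvector [(1, -1, 1)] in front
    of the last two vectors of the standard basis. *)
Lemma burauM_block (K : fieldType) (t : K) : t != 0 ->
  exists2 S : 'M[K]_3, S \in unitmx &
  exists C : 'M[K]_(2, 1),
  S *m burauM t = (block_mx (- t)%:M 0 C (burau_quot t) : 'M_(1 + 2)) *m S.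
Proof.
move=> t0; pose S : 'M[K]_3 := mx3 1 (- 1) 1  0 1 0  0 0 1.
exists S.
  pose S' : 'M[K]_3 := mx3 1 1 (- 1)  0 1 0  0 0 1.
  suff /mulmx1_unit[] : S *m S' = 1%:M by [].
  apply/matrixP=> -[[|[|[|//]]] Hi] -[[|[|[|//]]] Hj];
  rewrite !mxE !big_ord_recl big_ord0 !mxE /=; by ring.
pose T : 'M[K]_3 := mx3 (- t) 0 0  1 (2%:R - t^-1) (- 2%:R)  0 t (- t).
exists (\matrix_(i, j) nth 0 [:: 1; 0] i).
set C := \matrix_(i, j) _.
have -> : block_mx (- t)%:M 0 C (burau_quot t) = T :> 'M[K]_(1 + 2).
  apply/matrixP=> i j; rewrite mxE.
  case: (splitP i) => i' hi; rewrite mxE; case: (splitP j) => j' hj;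
    rewrite !mxE hi hj ?ord1 //=.
  - by case: j' {hj} => -[|[|//]].
  - by case: i' {hi} => -[|[|//]].
  - by case: i' {hi} => -[|[|//]] ?; case: j' {hj} => -[|[|//]].
apply/matrixP=> -[[|[|[|//]]] Hi] -[[|[|[|//]]] Hj];
rewrite !mxE !big_ord_recl !big_ord0 !mxE /=; by field.
Qed.

Lemma det_burauM_odd (K : fieldType) (z : K) (n : nat) : z != 0 ->
  \det (1%:M - burauM (- z) ^+ (2 * n + 1)) =
  (z - 1) * z ^+ n * (z + z^-1) *
    (chebW_at n (z + z^-1) * chebW_at n (z + z^-1 + 2%:R) ^+ 2).
Proof.
move=> z0; have t0 : - z != 0 by rewrite oppr_eq0.
have [S uS [C SM]] := burauM_block t0.
set q := (2 * n + 1)%N.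
have SMk k : S *m burauM (- z) ^+ k =
    (block_mx (- - z)%:M 0 C (burau_quot (- z)) : 'M_(1 + 2)) ^+ k *m S.
  elim: k => [|k IH]; first by rewrite !expr0 mulmx1 mul1mx.
  by rewrite exprSr -[_ * burauM _]/(_ *m _) mulmxA IH -mulmxA SM mulmxA exprSr.
have dS : \det S != 0 by move: uS; rewrite unitmxE unitfE.
have -> : \det (1%:M - burauM (- z) ^+ q) =
    \det (1%:M - (block_mx (- - z)%:M 0 C (burau_quot (- z)) : 'M_(1 + 2)) ^+ q).
  apply: (mulfI dS); rewrite -det_mulmx mulmxBr mulmx1 SMk.
  by rewrite -[X in X - _]mul1mx -mulmxBl det_mulmx mulrC.
rewrite det_sub1_lblock opprK -rmorphXn /= -rmorphB det_scalar1.
have zq : z ^+ q - 1 = chebW_at n (z + z^-1) * ((z - 1) * z ^+ n).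
  (* The field acts on itself, so scaling by [z + 1/z] is multiplication. *)
  apply: (@expr_odd_sub1 K K^o).
  by rewrite -[RHS]/((z + z^-1) * z) mulrDl mulVf // expr2.
have det2 (A : 'M[K]_2) : \det A = A 0 0 * A 1 1 - A 0 1 * A 1 0.
  by rewrite (expand_det_row _ 0) !big_ord_recl big_ord0 /cofactor !det_mx11 !mxE /=
     addr0 expr0 mul1r expr1 mulN1r mulrN; congr (_ * A _ _ - A _ _ * A _ _);
     apply: val_inj.
have detN : \det (burau_quot (- z)) = 1 by rewrite det2 !mxE /=; field.
have detN1 : \det (burau_quot (- z) - 1) = - (z + z^-1).
  by rewrite det2 !mxE /=; field; rewrite t0 z0.
have Nq : burau_quot (- z) ^+ q - 1 =
    chebW_at n (z + z^-1 + 2%:R) *: ((burau_quot (- z) - 1) * burau_quot (- z) ^+ n).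
  (* The hypothesis is Cayley-Hamilton, checked entry by entry. *)
  apply: expr_odd_sub1; rewrite expr2.
  apply/matrixP=> -[[|[|//]] Hi] -[[|[|//]] Hj];
  rewrite !mxE !big_ord_recl big_ord0 !mxE /=; field; rewrite ?t0 ?z0 //.
have detNn k : \det (burau_quot (- z) ^+ k) = 1.
  by elim: k => [|k IH]; rewrite ?det1 // exprS det_mulmx IH detN mulr1.
have -> : 1 - z ^+ q = - (z ^+ q - 1) by rewrite opprB.
have -> : 1%:M - burau_quot (- z) ^+ q = - (burau_quot (- z) ^+ q - 1) by rewrite opprB.
rewrite zq Nq -scaleN1r !detZ.
rewrite det_mulmx detN1 detNn; ring.
Qed.

(** * Evaluation at z + 1/z *)

(** If [P] has degree [m], then [z^m P(z + 1/z)] is a polynomial in [z] whose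
    constant term is the leading coefficient of [P]; so [P(z + 1/z) = 0] forces
    [P = 0]. *)
Lemma at_u_inj : injective at_u.
Proof.
have z0 : zvar != 0 by rewrite /zvar tofrac_eq0 polyX_eq0.
suff at0 (P : {poly int}) : at_u P = 0 -> P = 0.
  move=> P Q ePQ; apply/eqP; rewrite -subr_eq0; apply/eqP/at0.
  by rewrite /at_u rmorphB hornerD hornerN; apply/eqP; rewrite subr_eq0; apply/eqP.
move=> P0; apply/eqP; rewrite -lead_coef_eq0 lead_coefE.
set m := (size P).-1.
pose Q : {poly int} := \sum_(i < m.+1) P`_i *: (('X ^+ 2 + 1) ^+ i * 'X^(m - i)).
have Q0 : Q = 0.
  apply/eqP; rewrite -tofrac_eq0; apply/eqP.
  suff -> : FracField.tofrac Q = zvar ^+ m * at_u P by rewrite P0 mulr0.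
  rewrite /at_u (@horner_coef_wide _ m.+1); last first.
    by apply: (leq_trans (size_poly _ _)); apply: leqSpred.
  rewrite rmorph_sum mulr_sumr; apply: eq_bigr => i _.
  rewrite -mul_polyC !rmorphM !rmorphXn rmorphD rmorphXn rmorph1 coef_map.
  rewrite -/zvar /=.
  have -> : FracField.tofrac (P`_i)%:P = (P`_i)%:~R.
    by rewrite -[P`_i in LHS]intz !rmorph_int.
  rewrite [RHS]mulrCA; congr (_ * _).
  have -> : zvar ^+ m = zvar ^+ i * zvar ^+ (m - i).
    by rewrite -exprD subnKC // -ltnS.
  rewrite [RHS]mulrAC.
  by rewrite -exprMn mulrDr mulfV // expr2.
(* At 0 only the last term of [Q], that of index [m], survives. *)
have := congr1 (fun p => p.[0]) Q0; rewrite /Q horner_sum horner0 big_ord_recr /=.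
rewrite big1 ?add0r => [|i _]; last first.
  by rewrite !hornerE expr0n subn_eq0 leqNgt ltn_ord /= !mulr0.
by rewrite subnn !hornerE /= expr1n !mulr1 => ->.
Qed.

(** * Comparison with the Chebyshev polynomials of the second kind *)

(** Every point of the open interval from -1 to 1 is [cos t] with [sin t]
    nonzero, so [P - Q] has infinitely many roots; the points [1/(k+2)] serve
    as distinct samples. *)
Lemma poly_eq_on_cos (R : realType) (P Q : {poly R}) :
  (forall t : R, sin t != 0 -> P.[cos t] = Q.[cos t]) -> P = Q.
Proof.
move=> ePQ; apply/eqP; rewrite -subr_eq0; apply/eqP.
pose rs := [seq (k.+2%:R : R)^-1 | k <- iota 0 (size (P - Q))].
apply: (@roots_geq_poly_eq0 _ _ rs).
- apply/allP => x /mapP[k _ ->]; rewrite rootE.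
  set y : R := _^-1.
  have y0 : 0 < y by rewrite invr_gt0 ltr0n.
  have y1 : y < 1 by rewrite invf_lt1 ?ltr0n // ltr1n.
  have yI : -1 <= y <= 1 by rewrite (ltW y1) andbT (le_trans _ (ltW y0)) // lerN10.
  rewrite -[y]acosK ?in_itv //= hornerD hornerN ePQ ?subrr //.
  rewrite sin_acos //= sqrtr_eq0 -ltNge subr_gt0.
  by rewrite expr_lt1 // ltW.
- rewrite map_inj_uniq ?iota_uniq // => i j /invr_inj /eqP.
  by rewrite eqr_nat => /eqP[].
- by rewrite size_map size_iota.
Qed.

Lemma chebW_at_cos (R : realType) (n : nat) (t : R) :
  chebW_at n (2%:R * cos t) * sin t = sin (n.+1%:R * t) + sin (n%:R * t).
Proof.
have [] // : chebW_at n (2%:R * cos t) * sin t = sin (n.+1%:R * t) + sin (n%:R * t) /\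
  chebW_at n.+1 (2%:R * cos t) * sin t = sin (n.+2%:R * t) + sin (n.+1%:R * t).
have sin_rec k : sin (k.+2%:R * t) = 2%:R * cos t * sin (k.+1%:R * t) - sin (k%:R * t).
  have -> : k.+2%:R * t = k.+1%:R * t + t by rewrite -natr1; ring.
  have -> : k%:R * t = k.+1%:R * t + - t by rewrite -[k.+1%:R]natr1; ring.
  rewrite !sinD sinN cosN; ring.
elim: n => [|n [IH0 IH1]].
  rewrite chebW_at0 chebW_at1 sin_rec !mul1r mul0r sin0; split; ring.
split=> //; rewrite chebW_atSS mulrBl -mulrA IH0 IH1 (sin_rec n.+1) (sin_rec n); ring.
Qed.

Lemma chebW_chebF (R : realType) (U : nat -> {poly R}) (n : nat) :
  (forall k, is_chebyshevU k (U k)) -> (0 < n)%N ->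
  map_poly intr (chebW n) = chebF U n.
Proof.
move=> hU n0.
have two0 : (2%:R : R) != 0 by rewrite pnatr_eq0.
rewrite /chebF; suff <- : map_poly intr (chebW n) \Po (2%:R *: 'X) = U n + U n.-1 :> {poly R}.
  by rewrite -comp_polyA comp_polyZ comp_polyX scalerA mulfV // scale1r comp_polyXr.
apply: poly_eq_on_cos => t st.
rewrite horner_comp !hornerE (hU n t st) (hU n.-1 t st) prednK // -mulrDl.
by rewrite -chebW_at_cos mulfK.
Qed.

(** * The factorization *)

(** Since [1 - z + z^2 - z^3 = - (z - 1) (z^2 + 1) = - z (z - 1) (z + 1/z)],
    the denominator and the power of [z] cancel all of the prefactor that
    [det_burauM_odd] leaves in front of the Chebyshev factors. *)
Lemma nabla_normalization (K : fieldType) (z G : K) (n : nat) :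
  z != 0 -> 1 - z + z ^+ 2 - z ^+ 3 != 0 ->
  z ^- (3 * n) * (- z ^+ (2 * n + 1) *
    ((z - 1) * z ^+ n * (z + z^-1) * G) / (1 - z + z ^+ 2 - z ^+ 3)) = G.
Proof.
move=> z0 d0.
have -> : z ^+ (3 * n) = (z ^+ n) ^+ 3 by rewrite mulnC exprM.
rewrite addn1 (exprS _ (2 * n)) (mulnC 2 n) exprM.
have : z ^+ n != 0 by rewrite expf_neq0.
move: (z ^+ n) => y y0.
field.
by rewrite y0 z0 d0.
Qed.

Lemma at_u_chebW_nabla (n : nat) :
  at_u (chebW n * (chebW n \Po ('X + 2%:P)) ^+ 2) = nabla n.
Proof.
have z0 : zvar != 0 by rewrite /zvar tofrac_eq0 polyX_eq0.
have d0 : 1 - zvar + zvar ^+ 2 - zvar ^+ 3 != 0.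
  rewrite /zvar -!rmorphXn -(tofrac1 {poly int}) -!(rmorphB, rmorphD).
  (* At 2 this polynomial takes the value -5. *)
  rewrite tofrac_eq0; apply/eqP => /(congr1 (fun p => p.[2])).
  by rewrite !hornerE.
rewrite /nabla /alexA det_burauM_odd //.
have -> : at_u (chebW n * (chebW n \Po ('X + 2%:P)) ^+ 2) =
   chebW_at n (zvar + zvar^-1) * chebW_at n (zvar + zvar^-1 + 2%:R) ^+ 2.
  rewrite /at_u rmorphM rmorphXn /= map_comp_poly hornerM horner_exp horner_comp.
  by rewrite rmorphD /= map_polyX map_polyC !hornerE.
exact/esym/nabla_normalization.
Qed.

Theorem theorem3p7 (R : realType) (U : nat -> {poly R})
    (hU : forall k : nat, is_chebyshevU k (U k)) (n : nat) (hn : (1 <= n)%N) :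
  exists F B : {poly int},
    [/\ map_poly intr F = chebF U n,
        unique (fun P : {poly int} => at_u P = nabla n) B
      & B = F * (F \Po ('X + 2%:P)) ^+ 2].
Proof.
exists (chebW n), (chebW n * (chebW n \Po ('X + 2%:P)) ^+ 2); split=> //.
- exact: chebW_chebF.
- by split=> [|P hP]; [exact: at_u_chebW_nabla | apply: at_u_inj; rewrite hP at_u_chebW_nabla].
Qed.
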